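(* Let $\Theta$ be an $n\times m$ phase matrix, with $n\leq m$, and let $k$ be the smallest positive integer such that $m<\frac{2^{k-1}}{k}$. Then $$\operatorname{rank}_{\text{phase}}(\Theta)\leq n-\left\lfloor\frac{n-1}{k-1}\right\rfloor.$$
   Context: Let $S^1=\{z\in\mathbb{C}:|z|=1\}$ and $\mathbb{C}^*=\mathbb{C}\setminus\{0\}$. A phase matrix is a matrix with all entries in $S^1$. For an $n\times m$ phase matrix $\Theta$, its phase rank is $$\operatorname{rank}_{\text{phase}}(\Theta)=\min\{\operatorname{rank}(M): M\in(\mathbb{C}^* )^{n\times m},\ \tfrac{M_{ij}}{|M_{ij}|}=\Theta_{ij}\ \text{for all } i,j\},$$ where $\operatorname{rank}$ is the usual rank over $\mathbb{C}$. *)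

(* Defs.v *)
From mathcomp Require Import all_boot all_order all_algebra.
From mathcomp Require Import boolp reals.
From mathcomp Require Import complex.

Set Implicit Arguments.
Unset Strict Implicit.
Unset Printing Implicit Defensive.

Import Order.TTheory GRing.Theory Num.Theory.
Local Open Scope ring_scope.

Definition phase_matrix (R : realType) (n m : nat) (Theta : 'M[R[i]]_(n, m)) :
    Prop :=
  forall i j, `|Theta i j| = 1.

Definition has_phases (R : realType) (n m : nat)
    (Theta M : 'M[R[i]]_(n, m)) : Prop :=
  forall i j, M i j != 0 /\ M i j / `|M i j| = Theta i j.

Definition realizable_rank (R : realType) (n m : nat)
    (Theta : 'M[R[i]]_(n, m)) (r : nat) : Prop :=
  exists M : 'M[R[i]]_(n, m), has_phases Theta M /\ \rank M = r.

Lemma realizable_rank_ex (R : realType) (n m : nat)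
    (Theta : 'M[R[i]]_(n, m)) :
  phase_matrix Theta -> exists r, `[< realizable_rank Theta r >].
Proof.
move=> phT; exists (\rank Theta); apply/asboolP; exists Theta; split=> // i j.
by rewrite -normr_eq0 phT oner_eq0 invr1 mulr1.
Qed.

(* The minimum is over a nonempty set only when Theta is a phase matrix, hence
   the proof argument; the value does not depend on it. *)
Definition phase_rank (R : realType) (n m : nat) (Theta : 'M[R[i]]_(n, m))
    (phT : phase_matrix Theta) : nat :=
  ex_minn (realizable_rank_ex phT).

(* Main.v *)
(** Write the number of rows as [1 + q (k-1) + rest] and group row 0 with each of
    [q] disjoint sets of [k-1] further rows.  It suffices to rescale the entries
    positively so that the [k] rows of each group satisfy a linear relation with
    nonzero coefficients: each column can then be rescaled so that the relations
    use the same row 0, and they give [q] independent left kernel vectors.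

    A relation [sum_i c_i r_ij T_ij = 0] with all [r_ij > 0] exists for column [j]
    as soon as the points [c_i T_ij] do not lie in a half-plane.  Take
    [c_i = +- a_i] with [a] generic, so that no two points of a column are
    parallel.  A sign vector which puts a column in a half-plane is determined by
    the extreme clockwise point and its sign, so there are at most [2k] of them
    (the discrete form of Wendel's theorem); as [m * 2k < 2^k], some sign vector
    is good for all the columns. *)

Require Import Defs.
From mathcomp Require Import all_boot all_order all_algebra.
From mathcomp Require Import boolp reals.
From mathcomp Require Import complex.
From mathcomp Require Import ring lra.

Set Implicit Arguments.
Unset Strict Implicit.
Unset Printing Implicit Defensive.

Import Order.TTheory GRing.Theory Num.Theory.
Local Open Scope ring_scope.

(** * Plane vectors, half-planes and positive relations *)

Definition cross (R : pzRingType) (x y : R[i]) : R :=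
  complex.Re x * complex.Im y - complex.Im x * complex.Re y.

Definition dot (R : pzRingType) (x y : R[i]) : R :=
  complex.Re x * complex.Re y + complex.Im x * complex.Im y.

Lemma crossC (R : comPzRingType) (x y : R[i]) : cross x y = - cross y x.
Proof. by rewrite /cross; ring. Qed.

Lemma dot_gt0 (R : realDomainType) (x : R[i]) : x != 0 -> 0 < dot x x.
Proof.
case: x => a b; rewrite eq_complex /dot /= -!expr2 => ab.
rewrite lt_def addr_ge0 ?sqr_ge0// andbT paddr_eq0 ?sqr_ge0//.
by rewrite !sqrf_eq0.
Qed.

Lemma card_half_plane_signs (R : realDomainType) (k : nat) (v : 'I_k -> R[i]) :
  (#|[set s : {ffun 'I_k -> bool} | [exists i, forall l,
      (l != i) ==> (0 < (-1) ^+ s i * (-1) ^+ s l * cross (v i) (v l))%R]]|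
   <= 2 * k)%N.
Proof.
(* Once the extreme clockwise index and its sign are fixed, each other sign is forced by the side of
   [v p.2] on which [v l] lies. *)
pose g (p : bool * 'I_k) : {ffun 'I_k -> bool} :=
  [ffun l => if l == p.2 then p.1 else p.1 (+) (cross (v p.2) (v l) < 0)].
apply: (@leq_trans #|g @: setT|); last first.
  by rewrite (leq_trans (leq_imset_card _ _))// cardsT card_prod card_bool card_ord.
apply/subset_leq_card/subsetP => s; rewrite inE => /existsP[i /forallP sP].
apply/imsetP; exists (s i, i) => //; apply/ffunP => l; rewrite ffunE /=.
have [->//|li] := eqVneq l i; have := implyP (sP l) li.
case: (s i); case: (s l); rewrite ?(expr1, expr0, mulN1r, mulrN1, opprK, mul1r)//=;
  case: ltrP => //; lra.
Qed.

(** The vector [w l] furthest clockwise on the right of [w i] still has some [w u] on its own right,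
    which must then lie left of [w i]; so the triangle encloses the origin. *)
Lemma plane_triangle (R : realFieldType) (k : nat) (w : 'I_k -> R[i]) :
  (forall i l, i != l -> cross (w i) (w l) != 0) ->
  (forall i, exists l, cross (w i) (w l) < 0) ->
  forall i, exists u l, [/\ 0 < cross (w u) (w l), 0 < cross (w l) (w i)
    & 0 < cross (w i) (w u)].
Proof.
move=> w_gen w_right i; have [l1 l1P] := w_right i.
(* the vector furthest clockwise from [w i] within the open half-plane to its
   right *)
case: (@Order.TotalTheory.arg_minP _ _ 'I_k l1 (fun l => cross (w i) (w l) < 0)
  (fun l => dot (w i) (w l) / - cross (w i) (w l)) l1P) => l lP l_min.
have [u uP] := w_right l.
have lu : 0 < cross (w u) (w l) by rewrite crossC oppr_gt0.
have li : 0 < cross (w l) (w i) by rewrite crossC oppr_gt0.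
exists u, l; split=> //.
have iu : i != u by apply: contraTneq uP => <-; rewrite -leNgt ltW.
rewrite lt_def w_gen//= leNgt; apply/negP => iu0.
(* The minimised quotient is the cotangent of the clockwise angle from [w i], so a [u] on the right
   of [w i] would beat [l]. *)
have := l_min u iu0; rewrite ler_pdivrMr ?oppr_gt0// mulrAC ler_pdivlMr ?oppr_gt0//.
rewrite leNgt => /negP; apply.
have n0 : 0 < dot (w i) (w i).
  by apply: dot_gt0; apply: contraTneq iu0 => ->; rewrite /cross !mul0r subrr ltxx.
rewrite -subr_gt0.
suff -> : dot (w i) (w l) * - cross (w i) (w u) - dot (w i) (w u) * - cross (w i) (w l)
  = cross (w u) (w l) * dot (w i) (w i) by rewrite mulr_gt0.
by rewrite /cross /dot; ring.
Qed.

Lemma plane_pos_relation (R : rcfType) (k : nat) (w : 'I_k -> R[i]) :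
  (forall i l, i != l -> cross (w i) (w l) != 0) ->
  (forall i, exists l, cross (w i) (w l) < 0) ->
  exists r : 'I_k -> R, (forall i, 0 < r i) /\ \sum_i (r i)%:C%C * w i = 0.
Proof.
move=> w_gen w_right.
have: forall i, exists r : {ffun 'I_k -> R},
    [/\ 0 < r i, forall l, 0 <= r l & \sum_l (r l)%:C%C * w l = 0].
  move=> i; have [u [l [ul li iu]]] := plane_triangle w_gen w_right i.
  (* Cramer's rule: each of the three vectors is weighted by the cross product of the other two. *)
  exists [ffun p => (p == i)%:R * cross (w u) (w l)
    + (p == u)%:R * cross (w l) (w i) + (p == l)%:R * cross (w i) (w u)].
  split=> [|p|].
  - rewrite ffunE eqxx mul1r -addrA ltr_pwDl// addr_ge0// mulr_ge0// ?ler0n// ltW//.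
  - by rewrite ffunE !addr_ge0// mulr_ge0// ?ler0n// ltW.
  under eq_bigr => p _ do rewrite ffunE !rmorphD !rmorphM !rmorph_nat !mulrDl.
  rewrite !big_split /=.
  have sel (a : 'I_k) (c : R[i]) : \sum_p (p == a)%:R * c * w p = c * w a.
    rewrite (bigD1 a)//= eqxx mul1r big1 ?addr0// => p /negPf ->.
    by rewrite !mul0r.
  rewrite !sel; case: (w i) (w u) (w l) => [a b] [c d] [e f].
  by rewrite /cross; apply/eqP; rewrite eq_complex /=; apply/andP; split; apply/eqP; ring.
(* Adding the relations over all [i] makes every coefficient positive. *)
move=> /choice[r rP]; exists (fun l => \sum_i r i l); split=> [l|].
  rewrite (bigD1 l)//= ltr_pwDl//; first by case: (rP l).
  by apply: sumr_ge0 => p _; case: (rP p).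
under eq_bigr => l _ do rewrite rmorph_sum mulr_suml.
by rewrite exchange_big big1// => i _; case: (rP i).
Qed.

(** * Generic multipliers *)

Lemma poly_natr_nonroot (R : numDomainType) (p : {poly R}) :
  p != 0 -> exists n : nat, p.[n%:R] != 0.
Proof.
move=> p0; pose s : seq R := [seq n%:R | n <- iota 0 (size p)].
have [/(max_poly_roots p0)|] := boolP (all (root p) s).
  rewrite map_inj_uniq; last by move=> a b /eqP; rewrite eqr_nat => /eqP.
  by rewrite iota_uniq size_map size_iota ltnn => /(_ isT).
by case/allPn => _ /mapP[n _ ->] ?; exists n.
Qed.

Lemma generic_multipliers (R : realFieldType) (k m : nat)
    (T : 'I_k -> 'I_m -> R[i]) : (forall i j, T i j != 0) ->
  exists a : 'I_k -> R[i], (forall i, a i != 0) /\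
    forall i l j, i != l -> cross (a i * T i j) (a l * T l j) != 0.
Proof.
move=> T0.
(* Distinct values, nonzero so that [t - al i * 'i] does not vanish even at [t = 0]. *)
pose al (i : 'I_k) : R := i.+1%:R.
(* [p i l j] evaluated at [t] is the cross product of [(t - al i * 'i) T i j]
   and [(t - al l * 'i) T l j] *)
pose p i l j : {poly R} := (cross (T i j) (T l j))%:P * 'X^2
  + (dot (T i j) (T l j) * (al i - al l))%:P * 'X
  + (cross (T i j) (T l j) * al i * al l)%:P.
have p0 i l j : i != l -> p i l j != 0.
  (* If the coefficients of degrees 2 and 1 vanish, so do the cross and dot products, but their
     squares add up to the product of the squared norms. *)
  move=> il; apply/eqP => /polyP pE.
  have := pE 2; have := pE 1.
  rewrite !coefD !coefCM !coefXn !coefX !coefC/= !(mulr1, mulr0, addr0, add0r).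
  move=> /eqP; rewrite mulf_eq0 => /orP[/eqP d0 c0|]; last first.
    by rewrite subr_eq0 eqr_nat eqSS => /eqP/val_inj/eqP; rewrite (negPf il).
  have: 0 < dot (T i j) (T i j) * dot (T l j) (T l j) by rewrite mulr_gt0 ?dot_gt0.
  have -> : dot (T i j) (T i j) * dot (T l j) (T l j) =
    dot (T i j) (T l j) ^+ 2 + cross (T i j) (T l j) ^+ 2.
    by rewrite /dot /cross; ring.
  by rewrite d0 c0 !expr0n addr0 ltxx.
have /poly_natr_nonroot[t] : \prod_i \prod_(l | i != l) \prod_j p i l j != 0.
  by apply/prodf_neq0 => i _; apply/prodf_neq0 => l il; apply/prodf_neq0 => j _; exact: p0.
rewrite horner_prod => /prodf_neq0 tP.
exists (fun i => (t%:R +i* - al i)%C); split=> [i|i l j il].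
  by rewrite eq_complex /= negb_and oppr_eq0 (pnatr_eq0 _ i.+1) orbT.
have := tP i isT; rewrite horner_prod => /prodf_neq0/(_ l il).
rewrite horner_prod => /prodf_neq0/(_ j isT); rewrite !hornerE.
congr (_ != _); rewrite /cross /dot; case: (T i j) (T l j) => [a b] [c d] /=.
ring.
Qed.

(** * A relation within one block *)

Lemma phase_block_relation (R : realType) (k m : nat) (T : 'M[R[i]]_(k, m)) :
  phase_matrix T -> (m * (2 * k) < 2 ^ k)%N ->
  exists (c : 'I_k -> R[i]) (r : 'I_k -> 'I_m -> R),
    [/\ forall i, c i != 0, forall i j, 0 < r i j
      & forall j, \sum_i c i * ((r i j)%:C%C * T i j) = 0].
Proof.
move=> phT mk.
have [a [a0 a_gen]] : exists a : 'I_k -> R[i], (forall i, a i != 0) /\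
    forall i l j, i != l -> cross (a i * T i j) (a l * T l j) != 0.
  by apply: generic_multipliers => i j; rewrite -normr_eq0 phT oner_eq0.
pose bad j := [set s : {ffun 'I_k -> bool} | [exists i, forall l, (l != i) ==>
  (0 < (-1) ^+ s i * (-1) ^+ s l * cross (a i * T i j) (a l * T l j))%R]].
have [s sP] : exists s, s \notin \bigcup_j bad j.
  apply/existsP; rewrite -negb_forall; apply: contraL mk => /forallP sP.
  rewrite -leqNgt.
  apply: (@leq_trans #|\bigcup_j bad j|).
    have -> : \bigcup_j bad j = setT by apply/setP => s; rewrite in_setT sP.
    by rewrite cardsT card_ffun card_bool card_ord.
  have: (\sum_(j < m) #|bad j| <= m * (2 * k))%N.
    rewrite -[m in (m * _)%N]card_ord -sum_nat_const; apply: leq_sum => j _.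
    exact: (card_half_plane_signs (fun i => a i * T i j)).
  apply: leq_trans.
  elim/big_ind2: _ => [|n1 A n2 B h1 h2|//]; first by rewrite cards0.
  by rewrite (leq_trans (leq_card_setU _ _).1)// leq_add.
pose c i : R[i] := (-1) ^+ s i * a i.
have crossE i l j : cross (c i * T i j) (c l * T l j) =
    (-1) ^+ s i * (-1) ^+ s l * cross (a i * T i j) (a l * T l j).
  rewrite /c -!mulrA; case: (a i * T i j) (a l * T l j) => [x y] [z t].
  by case: (s i); case: (s l); rewrite /cross /= ?expr0 ?expr1 ?mul1r ?mulN1r/=; ring.
have cross_gen j i l : i != l -> cross (c i * T i j) (c l * T l j) != 0.
  by move=> il; rewrite crossE mulf_neq0 ?a_gen// mulf_neq0// signr_eq0.
have /choice[r rP] : forall j, exists r : 'I_k -> R,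
    (forall i, 0 < r i) /\ \sum_i (r i)%:C%C * (c i * T i j) = 0.
  move=> j; apply: plane_pos_relation; first exact: cross_gen.
  (* If nothing lies to the right of point [i], it is extreme clockwise and [s] is bad for column
     [j]. *)
  move=> i; move: sP; apply: contraNP => /forallNP iP.
  apply/bigcupP; exists j => //; rewrite inE; apply/existsP; exists i.
  apply/forallP => l; apply/implyP => li.
  rewrite -crossE lt_def cross_gen 1?eq_sym//= leNgt; exact/negP.
exists c, (fun i j => r j i); split=> [i|i j|j].
- by rewrite mulf_neq0// signr_eq0.
- by case: (rP j).
- by have [_ jP] := rP j; rewrite -[RHS]jP; apply: eq_bigr => i _; rewrite mulrCA.
Qed.

(** * Gluing the blocks along row 0 *)

Lemma phase_rank_le_rank (R : realType) (n m : nat) (T M : 'M[R[i]]_(n, m))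
    (phT : phase_matrix T) : has_phases T M -> (phase_rank phT <= \rank M)%N.
Proof.
move=> TM; rewrite /phase_rank; case: ex_minnP => r _; apply.
by apply/asboolP; exists M.
Qed.

Lemma has_phases_scale (R : realType) (n m : nat) (T : 'M[R[i]]_(n, m))
    (r : 'I_n -> 'I_m -> R) : phase_matrix T -> (forall i j, 0 < r i j) ->
  has_phases T (\matrix_(i, j) ((r i j)%:C%C * T i j)).
Proof.
move=> phT r0 i j; have rC0 : 0 < (r i j)%:C%C :> R[i] by rewrite ltcR.
rewrite mxE normrM phT mulr1 gtr0_norm//; split; last first.
  by rewrite mulrAC divff ?mul1r// gt_eqF.
by rewrite mulf_neq0 ?(gt_eqF rC0)// -normr_eq0 phT oner_eq0.
Qed.

(** A block has [k.+2] rows, the shared row 0 and [k.+1] private ones, and lowers the rank by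
    one. *)
Lemma phase_rank_block_bound (R : realType) (n m k : nat)
    (T : 'M[R[i]]_(n.+1, m)) (phT : phase_matrix T) :
  (m * (2 * k.+2) < 2 ^ k.+2)%N ->
  (n %/ k.+1 + phase_rank phT <= n.+1)%N.
Proof.
move=> mk; set q := (n %/ k.+1)%N.
(* The [b]-th block consists of row 0 and rows [b (k+1) + 1], up to
   [b (k+1) + k + 1]. *)
pose e (b : nat) (s : 'I_k.+2) : 'I_n.+1 :=
  inord (if s == 0%R then 0 else (b * k.+1 + s.-1).+1)%N.
have eE b s : (b < q)%N ->
    e b s = (if s == 0%R then 0 else (b * k.+1 + s.-1).+1)%N :> nat.
  move=> bq; rewrite inordK//; case: eqP => // _; rewrite ltnS.
  apply: (leq_trans _ (leq_divM n k.+1)); rewrite -/q.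
  apply: leq_trans (leq_mul bq (leqnn _)).
  by rewrite mulSn -addnS addnC leq_add2r; case: s => -[].
have eP b s : (b < q)%N -> s != 0 ->
    [/\ e b s != 0, ((e b s).-1 %/ k.+1)%N = b & ((e b s).-1 %% k.+1)%N = s.-1].
  move=> bq /negPf s0.
  have sk : (s.-1 < k.+1)%N by case: s s0 => -[].
  have := eE b s bq; rewrite s0 => ebs; split.
  - by rewrite -val_eqE /= ebs.
  - by rewrite ebs /= divnMDl// divn_small ?addn0.
  - by rewrite ebs /= modnMDl modn_small.
have /choice[c /choice[r rP]] : forall b, exists (c : 'I_k.+2 -> R[i])
    (r : 'I_k.+2 -> 'I_m -> R), [/\ forall i, c i != 0, forall i j, 0 < r i j
      & forall j, \sum_i c i * ((r i j)%:C%C * rowsub (e b) T i j) = 0].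
  move=> b; apply: phase_block_relation => // i j; rewrite mxE; exact: phT.
(* Dividing by [r b 0 j] gives row 0 the factor 1 in every block, so that the blocks can share it.
   Rows left over only need a positive factor. *)
pose rho (i : 'I_n.+1) j : R := if i == 0 then 1 else
  let b := (i.-1 %/ k.+1)%N in r b (inord (i.-1 %% k.+1).+1) j / r b 0 j.
have r_gt0 b i j : 0 < r b i j by case: (rP b).
have rho_gt0 i j : 0 < rho i j by rewrite /rho; case: ifP => // _; rewrite divr_gt0.
pose M : 'M_(n.+1, m) := \matrix_(i, j) ((rho i j)%:C%C * T i j).
suff rankM : (q + \rank M <= n.+1)%N.
  apply: leq_trans rankM; rewrite leq_add2l; apply: phase_rank_le_rank.
  exact: has_phases_scale.
have rhoE b s j : (b < q)%N -> rho (e b s) j = r b s j / r b 0 j.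
  move=> bq; have [->|s0] := eqVneq s 0.
    have -> : e b 0 = 0 by apply: val_inj; rewrite /= eE.
    by rewrite /rho eqxx divff// gt_eqF.
  have [/negPf e0 ediv emod] := eP b s bq s0; rewrite /rho e0 ediv emod prednK.
    by rewrite inord_val.
  by rewrite lt0n.
pose C : 'M[R[i]]_(q, n.+1) :=
  \matrix_b (\sum_s c b s *: delta_mx 0 (e b s)).
have CM : C *m M = 0.
  apply/row_matrixP => b; rewrite row_mul rowK row0 mulmx_suml.
  apply/rowP => j; rewrite summxE mxE.
  have [_ _ /(_ j) bj] := rP b.
  apply: etrans (mulr0 (r b 0 j)^-1%:C%C); rewrite -[in RHS]bj mulr_sumr.
  apply: eq_bigr => s _; rewrite -scalemxAl -rowE !mxE rhoE// rmorphM; ring.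
suff rankC : (q <= \rank C)%N.
  by apply: leq_trans (mulmx0_rank_max CM); rewrite leq_add2r.
(* Row [e b 1] belongs to block [b] alone, so the columns of [C] at these indices form a diagonal
   matrix, invertible since [c b 1] is nonzero. *)
pose D := diag_mx (\row_b c b (1 : 'I_k.+2)) : 'M_q.
have CD : C *m colsub (fun b : 'I_q => e b 1) 1%:M = D.
  rewrite mulmx_colsub mulmx1; apply/matrixP => b b'; rewrite !mxE summxE.
  rewrite (bigD1 1)//= big1 ?addr0 => [|s s1]; rewrite !mxE eqxx /=.
    have [->|bb'] := eqVneq b b'; first by rewrite eqxx mulr1.
    case: eqP => [eq_e|]; last by rewrite mulr0.
    case/eqP: bb'; apply: val_inj => /=.
    have [] // := eP b 1 (ltn_ord b); rewrite -eq_e => _ <- _.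
    by have [] // := eP b' 1 (ltn_ord b').
  case: eqP => [eq_e|]; last by rewrite mulr0.
  have [e0 ediv emod] := eP b' 1 (ltn_ord b') isT; case/eqP: s1.
  have s0 : s != 0.
    by apply: contraNneq e0 => s0; rewrite eq_e -val_eqE /= eE// s0.
  have [_ _ ] := eP b s (ltn_ord b) s0; rewrite -eq_e emod => s1.
  by apply: val_inj; rewrite /= -[val s]prednK ?lt0n// -s1.
have Du : D \in unitmx.
  rewrite unitmxE det_diag unitfE; apply/prodf_neq0 => b _; rewrite mxE.
  by case: (rP b).
by rewrite -[leqLHS](mxrank_unit Du) -CD mxrankM_maxl.
Qed.

Theorem proposition5p4 (R : realType) (n m k : nat)
    (Theta : 'M[R[i]]_(n, m)) (phT : phase_matrix Theta)
    (le_nm : (n <= m)%N)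
    (k_gt0 : (0 < k)%N)
    (k_bound : m%:R < 2 ^+ (k - 1) / k%:R :> R)
    (k_min : forall j : nat, (0 < j)%N -> m%:R < 2 ^+ (j - 1) / j%:R :> R ->
       (k <= j)%N) :
  (phase_rank phT <= n - (n - 1) %/ (k - 1))%N.
Proof.
have rank_le : (phase_rank phT <= n)%N.
  apply: leq_trans (phase_rank_le_rank phT (M := Theta) _) (rank_leq_row _).
  by move=> i j; rewrite phT divr1 -normr_eq0 phT oner_eq0.
(* For [k = 1] the quotient by [k - 1 = 0] is 0 by convention, and the bound is [n]. *)
case: k k_gt0 k_bound {k_min} => [//|[|k]] _ k_bound; first by rewrite divn0 subn0.
case: n Theta phT le_nm rank_le => [|n] Theta phT _ rank_le.
  by rewrite !sub0n.
rewrite !subSS !subn0 leq_subRL; last first.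
  by rewrite (leq_trans (leq_div _ _)).
apply: phase_rank_block_bound.
rewrite subSS subn0 ltr_pdivlMr ?ltr0n// -natrM -natrX ltr_nat in k_bound.
by rewrite expnS mulnCA ltn_pmul2l.
Qed.
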